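(* Let $\Phi(s)$ be a low-rank $(m+p)\times(m+p)$ rational spectral density (in continuous time) of rank $m$, partitioned as $$\Phi(s)=\begin{bmatrix}\Phi_{11}(s)&\Phi_{12}(s)\\ \Phi_{21}(s)&\Phi_{22}(s)\end{bmatrix},$$ where $\Phi_{11}$ is $m\times m$ and full-rank. Let $G_1(s)$ be a minimum-phase square spectral factor of $\Phi_{11}(s)$, let $H(s)=\Phi_{21}(s)\Phi_{11}(s)^{-1}$, and let the proper function $G_1(s)^\top H(s)^\top$ have a minimal realization $$G_1(s)^\top H(s)^\top=\left[\begin{array}{cc|c}A_u & A_{us} & B_u \\ 0 & A_s & B_s\\ \hline C_u & C_s&D\end{array}\right],$$ where the eigenvalues of $A_u$ and $A_s$ correspond respectively to the unstable and stable poles of $G_1(s)^\top H(s)^\top$. Then the Lyapunov equation $$A_u^*X+XA_u-C_u^*C_u=0$$ has a unique invertible Hermitian solution $X$, and all the minimum-phase full-column-rank spectral factors $W(s)$ of $\Phi(s)$ are given by $$W(s)=\begin{bmatrix}G_1(s)Q_1(s)\\ W_2(s)\end{bmatrix},$$ with $$W_2(s)=\left[\begin{array}{cc|c} A_u+MC_u & A_{us}+MC_s & B_u+MD \\ 0 & A_s & B_s\\ \hline PC_u & PC_s & PD \end{array}\right]^\top,\qquad Q_1(s)=\left[\begin{array}{c|c} A_u+MC_u & M \\ \hline PC_u & P \end{array}\right]^\top,$$ where $M=-X^{-1}C_u^*$ and $P$ is an arbitrary $m\times m$ unitary matrix.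
   Context: Here $m>0$, $p\ge 0$ are integers. A continuous-time rational spectral density is a rational matrix function $\Phi(s)$ that is Hermitian positive semidefinite on the imaginary axis and has no poles there (including infinity); its rank is its rank as a rational matrix, and $\Phi_{12}=\Phi_{21}^*$. For a rational matrix function of $s$, $W(s)^*=\overline{W(-\bar s)}^{\top}$ (the conjugate transpose of $W(s)$ on the imaginary axis); for a constant matrix, $A^*$ is the conjugate transpose. A spectral factor of $\Phi$ is a $W$ with $\Phi=WW^*$ (likewise $\Phi_{11}=G_1G_1^*$). $W(s)$ is minimum-phase (outer) if and only if all its poles are in the open left half plane and all its zeros are in the closed left half plane (zeros at infinity are not excluded). A point $\alpha$ in the region where $W$ is analytic is a (right) zero of $W$ if there is a nonzero vector $v$ with $W(\alpha)v=0$. Notation for realizations: $$\left[\begin{array}{c|c}A &B\\ \hline C&D\end{array}\right]:= C(sI-A)^{-1}B+D.$$ Unstable poles are those in the open right half plane; stable poles are those in the closed left half plane and at infinity. *)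

(* Defs.v *)
From HB Require Import structures.
From mathcomp Require Import all_boot all_order all_algebra.
From mathcomp Require Import sesquilinear spectral.
From mathcomp Require Export fraction.
From mathcomp Require Export complex.
From mathcomp Require Export reals.

Set Implicit Arguments.
Unset Strict Implicit.
Unset Printing Implicit Defensive.

Import Order.TTheory GRing.Theory Num.Theory.
Local Open Scope ring_scope.
Local Open Scope sesquilinear_scope.

Notation ratfun C := {fraction {poly C}}.

Local Notation "x %:F" := (FracField.tofrac x).

Section RationalFunctions.
Variable C : numClosedFieldType.
Implicit Types (f : ratfun C) (q n d : {poly C}) (a : C).

(* [\n_] and [\d_] need not be coprime on the canonical representative, hence
   the division by the gcd; the reduced form is unique up to a constant. *)
Definition rat_num f : {poly C} :=
  \n_(repr f) %/ gcdp \n_(repr f) \d_(repr f).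
Definition rat_den f : {poly C} :=
  \d_(repr f) %/ gcdp \n_(repr f) \d_(repr f).

Definition is_pole f a : bool := root (rat_den f) a.

(* No pole at infinity. *)
Definition proper_rat f : bool := (size (rat_num f) <= size (rat_den f))%N.

(* Meaningful when [a] is not a pole of [f]. *)
Definition rat_eval f a : C := (rat_num f).[a] / (rat_den f).[a].

(* s |-> conj (q (- conj s)), for a polynomial and for a rational function. *)
Definition para_poly q : {poly C} := map_poly Num.conj q \Po (- 'X).
Definition para_rat f : ratfun C :=
  (para_poly (rat_num f))%:F / (para_poly (rat_den f))%:F.

Lemma rat_den_neq0 f : rat_den f != 0.
Proof.
rewrite /rat_den; have dn0 := denom_ratioP (repr f).
by rewrite dvdp_div_eq0 ?dvdp_gcdr.
Qed.

Lemma tofrac_div_eq n d n' d' : d != 0 -> d' != 0 ->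
  (n%:F / d%:F == n'%:F / d'%:F :> ratfun C) = (n * d' == n' * d).
Proof.
by move=> d0 d'0; rewrite eqr_div ?tofrac_eq0 // -!tofracM tofrac_eq.
Qed.

Lemma rat_repr f : f = (\n_(repr f))%:F / (\d_(repr f))%:F.
Proof.
apply: (canRL (mulfK _)); first by rewrite tofrac_eq0 denom_ratioP.
rewrite -{1}[f]reprK; unlock FracField.tofrac.
rewrite -[LHS]FracField.pi_mul; apply/eqP; rewrite FracField.equivf_def.
rewrite /FracField.equivf /FracField.mulf.
by rewrite !numden_Ratio ?(mulr1, oner_eq0, denom_ratioP) // mulrC.
Qed.

Lemma rat_numden f : f = (rat_num f)%:F / (rat_den f)%:F.
Proof.
rewrite [LHS]rat_repr; apply/eqP; rewrite tofrac_div_eq ?rat_den_neq0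
  ?denom_ratioP //.
by rewrite /rat_num /rat_den divp_mulA ?dvdp_gcdr // divp_mulAC ?dvdp_gcdl.
Qed.

Lemma coprime_rat_numden f : coprimep (rat_num f) (rat_den f).
Proof.
by apply: coprimep_div_gcd; rewrite (denom_ratioP (repr f)) orbT.
Qed.

Lemma rat_evalP f n d a : f = n%:F / d%:F -> d.[a] != 0 ->
  ~~ is_pole f a /\ rat_eval f a = n.[a] / d.[a].
Proof.
move=> Ef da0.
have d0 : d != 0 by apply: contraNneq da0 => ->; rewrite horner0.
have E : n * rat_den f = rat_num f * d.
  apply/eqP; rewrite -tofrac_div_eq ?rat_den_neq0 //.
  by apply/eqP; rewrite -Ef; exact: rat_numden.
have ha : (rat_den f).[a] != 0.
  apply: contra da0 => /eqP ra.
  have : rat_den f %| rat_num f * d by rewrite -E dvdp_mull.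
  rewrite Gauss_dvdpr; last by rewrite coprimep_sym coprime_rat_numden.
  by case/dvdpP => q ->; rewrite hornerM ra mulr0.
split; first exact: ha.
by apply/eqP; rewrite eqr_div // -!hornerM E.
Qed.

End RationalFunctions.

Section RationalMatrices.
Variable C : numClosedFieldType.

Definition mx_is_pole m n (W : 'M[ratfun C]_(m, n)) (a : C) : Prop :=
  exists i j, is_pole (W i j) a.

Definition mx_proper m n (W : 'M[ratfun C]_(m, n)) : Prop :=
  forall i j, proper_rat (W i j).

Definition mx_eval m n (W : 'M[ratfun C]_(m, n)) (a : C) : 'M[C]_(m, n) :=
  map_mx (fun f => rat_eval f a) W.

(* W(s)^* = conj (W (- conj s))^T *)
Definition para m n (W : 'M[ratfun C]_(m, n)) : 'M[ratfun C]_(n, m) :=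
  map_mx (@para_rat C) W^T.

Definition psdmx n (A : 'M[C]_n) : Prop :=
  forall v : 'cV[C]_n, 0 <= (v^t* *m A *m v) 0 0.

Definition spectral_density n (Phi : 'M[ratfun C]_n) : Prop :=
  mx_proper Phi /\
  forall a : C, 'Re a = 0 ->
    [/\ ~ mx_is_pole Phi a, mx_eval Phi a \is hermsymmx
      & psdmx (mx_eval Phi a)].

Definition spectral_factor n r (Phi : 'M[ratfun C]_n) (W : 'M[ratfun C]_(n, r)) :
  Prop := Phi = W *m para W.

Definition is_zero m n (W : 'M[ratfun C]_(m, n)) (a : C) : Prop :=
  ~ mx_is_pole W a /\ exists2 v : 'cV[C]_n, v != 0 & mx_eval W a *m v = 0.

(* Infinity does not lie in the open left half plane, so it may not be a pole;
   it may be a zero. *)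
Definition minimum_phase m n (W : 'M[ratfun C]_(m, n)) : Prop :=
  [/\ mx_proper W,
      forall a : C, mx_is_pole W a -> 'Re a < 0
    & forall a : C, is_zero W a -> 'Re a <= 0].

Definition unstable_pole m n (W : 'M[ratfun C]_(m, n)) (a : C) : Prop :=
  mx_is_pole W a /\ 0 < 'Re a.

Definition stable_pole m n (W : 'M[ratfun C]_(m, n)) (a : C) : Prop :=
  mx_is_pole W a /\ 'Re a <= 0.

Definition const_ratmx m n (A : 'M[C]_(m, n)) : 'M[ratfun C]_(m, n) :=
  map_mx (fun c : C => (c%:P)%:F) A.

(* C (s I - A)^-1 B + D; s I - A is always invertible over the rational
   functions, its determinant being the characteristic polynomial of A. *)
Definition realization k m n (A : 'M[C]_n) (B : 'M[C]_(n, m)) (Co : 'M[C]_(k, n))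
    (D : 'M[C]_(k, m)) : 'M[ratfun C]_(k, m) :=
  const_ratmx Co *m invmx ((('X : {poly C})%:F)%:M - const_ratmx A)
    *m const_ratmx B + const_ratmx D.

(* A realization of least state dimension. *)
Definition minimal_realization k m n (F : 'M[ratfun C]_(k, m)) (A : 'M[C]_n)
    (B : 'M[C]_(n, m)) (Co : 'M[C]_(k, n)) (D : 'M[C]_(k, m)) : Prop :=
  F = realization A B Co D /\
  forall n' (A' : 'M[C]_n') (B' : 'M[C]_(n', m)) (Co' : 'M[C]_(k, n'))
    (D' : 'M[C]_(k, m)), F = realization A' B' Co' D' -> (n <= n')%N.

Definition lyapunov_solution k n (A : 'M[C]_n) (Co : 'M[C]_(k, n)) (X : 'M[C]_n) :
  Prop :=
  [/\ X \is hermsymmx, X \in unitmx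
    & A^t* *m X + X *m A - Co^t* *m Co = 0].

End RationalMatrices.

(* Main.v *)
From HB Require Import structures.
Require Import Defs.
From mathcomp Require Import all_boot all_order all_algebra.
From mathcomp Require Import sesquilinear spectral.

Set Implicit Arguments.
Unset Strict Implicit.
Unset Printing Implicit Defensive.

Import Order.TTheory GRing.Theory Num.Theory.
Local Open Scope ring_scope.
Local Open Scope sesquilinear_scope.

(** Existence of the factors and their uniqueness are two separate matters.

   Uniqueness ([minimum_phase_factor_unique]): on the imaginary axis
   [W *m para W] is the Gram matrix of the rows of [W]. Hence it has the rank
   of [W] and neither a pole on the axis nor one at infinity can cancel in it.
   Two full-column-rank factors of the same density thus differ by a square
   [U] with [U *m para U = 1], so [U] has no pole on the axis or at infinity.
   If both factors are minimum-phase, each is injective at every point of the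
   open right half plane, so neither [U] nor [para U], its inverse, has a pole
   there; by reflection [U] has none in the left half plane. A rational matrix
   without poles on the Riemann sphere is constant, and [U] is unitary.

   Existence: since the rank of the density is that of its upper left block,
   [col_mx G1 (H *m G1)] is a spectral factor ([low_rank_factor]), analytic in
   the right half plane except for the unstable poles of [F = G1^T *m H^T]. An
   all-pass [T] has to remove them without making new zeros. The output
   injection [M = - X^-1 Cu^*] replaces [Au] by [- X^-1 Au^* X], which is
   similar to the mirror image of [Au] and therefore stable, and the Lyapunov
   equation for [X] is exactly what makes [T] all-pass
   ([closed_loop_allpass]). The matrix [T *m F] is the same realization under
   output injection ([realization_output_injection]), and [T], [T *m F] share
   no left zero in the right half plane, because a common zero direction would
   be an uncontrollable mode of a minimal realization
   ([output_injection_coprime]). Observability of [(Au, Cu)], also a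
   consequence of minimality, is what makes the solution [X] of the Lyapunov
   equation invertible ([lyapunov_exists_unique]).

   These factors are those with [P = 1] multiplied on the right by constant
   unitary matrices, so uniqueness shows that there are no others. *)

Local Notation "x %:F" := (FracField.tofrac x).

(** * Rational functions, their para-conjugates and their values *)

Section RationalFunctionTheory.
Variable C : numClosedFieldType.
Implicit Types (f g : ratfun C) (q n d : {poly C}) (a b c : C).

Lemma rat_fracP f : exists n d, d != 0 /\ f = n%:F / d%:F.
Proof.
exists (rat_num f), (rat_den f); rewrite rat_den_neq0.
by split=> //; apply: rat_numden.
Qed.

Lemma tofrac_neq0 d : d != 0 -> d%:F != 0 :> ratfun C.
Proof. by rewrite tofrac_eq0. Qed.

Lemma tofrac_div_sub n d m e : d != 0 -> e != 0 ->
  n%:F / d%:F - m%:F / e%:F = (n * e - m * d)%:F / (d * e)%:F :> ratfun C.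
Proof.
by move=> d0 e0; rewrite -mulNr addf_div ?tofrac_neq0 // rmorphB !rmorphM mulNr.
Qed.

Lemma para_poly_is_zmod_morphism : zmod_morphism (@para_poly C).
Proof. by move=> p q; rewrite /para_poly rmorphB comp_polyB. Qed.

Lemma para_poly_is_monoid_morphism : monoid_morphism (@para_poly C).
Proof.
by split=> [|p q]; rewrite /para_poly ?rmorph1 ?rmorphM ?comp_polyC ?comp_polyM.
Qed.

HB.instance Definition _ :=
  GRing.isZmodMorphism.Build {poly C} {poly C} (@para_poly C)
    para_poly_is_zmod_morphism.
HB.instance Definition _ :=
  GRing.isMonoidMorphism.Build {poly C} {poly C} (@para_poly C)
    para_poly_is_monoid_morphism.

Lemma size_para_poly q : size (para_poly q) = size q.
Proof.
rewrite /para_poly size_comp_poly2 ?size_polyN ?size_polyX //.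
by rewrite size_map_inj_poly ?rmorph0 //; apply: fmorph_inj.
Qed.

Lemma para_poly_eq0 q : (para_poly q == 0) = (q == 0).
Proof. by rewrite -!size_poly_eq0 size_para_poly. Qed.

Lemma coef_para_poly q i : (para_poly q)`_i = (-1) ^+ i * (q`_i)^*.
Proof.
have cX j : ((- 'X) ^+ j : {poly C})`_i = (-1) ^+ j * (i == j)%:R.
  by rewrite -scaleN1r exprZn coefZ coefXn.
rewrite /para_poly coef_comp_poly -(coef_map Num.conj) /=.
have [lt_iq | le_qi] := ltnP i (size (map_poly Num.conj q)).
  rewrite (bigD1 (Ordinal lt_iq)) //= big1 => [|j ne_ji].
    by rewrite addr0 cX eqxx mulr1 mulrC.
  by rewrite cX eq_sym (negPf (_ : j != i :> nat)) // !mulr0.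
rewrite big1 => [|j _]; first by rewrite nth_default // mulr0.
by rewrite cX gtn_eqF ?mulr0 // (leq_trans (ltn_ord j)).
Qed.

Lemma horner_para_poly q a : (para_poly q).[- a^*] = (q.[a])^*.
Proof. by rewrite /para_poly horner_comp hornerN hornerX opprK horner_map. Qed.

Lemma para_polyK : involutive (@para_poly C).
Proof.
move=> q; apply/polyP=> i; rewrite !coef_para_poly rmorphM rmorphXn rmorphN1 /=.
by rewrite conjCK mulrA -exprMn mulrNN mulr1 expr1n mul1r.
Qed.

Lemma para_rat_frac f n d :
  d != 0 -> f = n%:F / d%:F -> para_rat f = (para_poly n)%:F / (para_poly d)%:F.
Proof.
move=> d0 Ef; apply/eqP; rewrite tofrac_div_eq ?para_poly_eq0 ?rat_den_neq0 //.
rewrite -!rmorphM; apply/eqP; congr (para_poly _); apply/eqP.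
by rewrite -tofrac_div_eq ?rat_den_neq0 // -Ef -rat_numden.
Qed.

Lemma para_rat_is_zmod_morphism : zmod_morphism (@para_rat C).
Proof.
move=> f g; have [n [d [d0 Ef]]] := rat_fracP f; have [m [e [e0 Eg]]] := rat_fracP g.
rewrite (para_rat_frac d0 Ef) (para_rat_frac e0 Eg).
rewrite (@para_rat_frac _ (n * e - m * d) (d * e)) ?mulf_neq0 //; last first.
  by rewrite Ef Eg; apply: tofrac_div_sub.
have -> : para_poly (n * e - m * d) =
    para_poly n * para_poly e - para_poly m * para_poly d.
  by rewrite rmorphB !rmorphM.
have -> : para_poly (d * e) = para_poly d * para_poly e by rewrite rmorphM.
by apply/esym; apply: tofrac_div_sub; rewrite para_poly_eq0.
Qed.

Lemma para_rat_is_monoid_morphism : monoid_morphism (@para_rat C).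
Proof.
split=> [|f g].
  by rewrite (@para_rat_frac _ 1 1) ?oner_neq0 ?rmorph1 ?divr1 //.
have [n [d [d0 Ef]]] := rat_fracP f; have [m [e [e0 Eg]]] := rat_fracP g.
rewrite (para_rat_frac d0 Ef) (para_rat_frac e0 Eg).
rewrite (@para_rat_frac _ (n * m) (d * e)) ?mulf_neq0 //; last first.
  by rewrite Ef Eg mulf_div !rmorphM.
by rewrite mulf_div !rmorphM.
Qed.

HB.instance Definition _ :=
  GRing.isZmodMorphism.Build (ratfun C) (ratfun C) (@para_rat C)
    para_rat_is_zmod_morphism.
HB.instance Definition _ :=
  GRing.isMonoidMorphism.Build (ratfun C) (ratfun C) (@para_rat C)
    para_rat_is_monoid_morphism.

Lemma para_rat_tofrac q : para_rat q%:F = (para_poly q)%:F.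
Proof.
by rewrite (@para_rat_frac _ q 1) ?oner_neq0 ?rmorph1 ?divr1.
Qed.

Lemma para_ratK : involutive (@para_rat C).
Proof.
move=> f; have [n [d [d0 ->]]] := rat_fracP f.
by rewrite (para_rat_frac d0 erefl) (para_rat_frac _ erefl) ?para_poly_eq0 //
  !para_polyK.
Qed.

(** Regularity and evaluation in a single relation, so that the values of sums
   and products come without regularity side conditions. *)
Definition value_at a f c : Prop :=
  exists n d, [/\ d.[a] != 0, f = n%:F / d%:F & c = n.[a] / d.[a]].

Lemma value_atP a f c : value_at a f c <-> ~~ is_pole f a /\ rat_eval f a = c.
Proof.
split=> [[n [d [da Ef ->]]] | [pf <-]]; first exact: rat_evalP.
by exists (rat_num f), (rat_den f); split; [exact: pf | exact: rat_numden |].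
Qed.

Lemma value_at_unique a f c c' : value_at a f c -> value_at a f c' -> c = c'.
Proof. by move=> /value_atP[_ <-] /value_atP[_ <-]. Qed.

Lemma horner_neq0 d a : d.[a] != 0 -> d != 0.
Proof. by apply: contraNneq => ->; rewrite horner0. Qed.

Lemma value_at_tofrac a q : value_at a q%:F q.[a].
Proof. by exists q, 1; rewrite hornerC oner_eq0 !divr1. Qed.

Lemma value_atB a f g c c' :
  value_at a f c -> value_at a g c' -> value_at a (f - g) (c - c').
Proof.
move=> [n [d [da -> ->]]] [m [e [ea -> ->]]].
exists (n * e - m * d), (d * e).
rewrite !(hornerD, hornerN, hornerM) mulf_neq0 //; split=> //.
  by rewrite tofrac_div_sub ?(@horner_neq0 _ a).
by rewrite -mulNr addf_div // mulNr.
Qed.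

Lemma value_atM a f g c c' :
  value_at a f c -> value_at a g c' -> value_at a (f * g) (c * c').
Proof.
move=> [n [d [da -> ->]]] [m [e [ea -> ->]]].
exists (n * m), (d * e).
rewrite !(hornerD, hornerN, hornerM) mulf_neq0 //; split=> //.
  by rewrite mulf_div !rmorphM.
by rewrite mulf_div.
Qed.

Lemma value_at0 a : value_at a 0 0.
Proof. by have := value_at_tofrac a 0; rewrite rmorph0 horner0. Qed.

Lemma value_atD a f g c c' :
  value_at a f c -> value_at a g c' -> value_at a (f + g) (c + c').
Proof.
move=> vf vg; rewrite -[g]opprK -[c']opprK -[- g]sub0r -[- c']sub0r.
by apply: value_atB => //; apply: value_atB => //; apply: value_at0.
Qed.

Lemma value_at_sum a (I : Type) (r : seq I) (F : I -> ratfun C) (G : I -> C) :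
  (forall i, value_at a (F i) (G i)) ->
  value_at a (\sum_(i <- r) F i) (\sum_(i <- r) G i).
Proof.
move=> FG; elim/big_ind2: _ => // [|f c g c']; first exact: value_at0.
exact: value_atD.
Qed.

Lemma value_at_para a f c : value_at a f c -> value_at (- a^*) (para_rat f) (c^*).
Proof.
move=> [n [d [da Ef ->]]]; exists (para_poly n), (para_poly d).
rewrite !horner_para_poly fmorph_eq0 da fmorph_div; split=> //.
by apply: para_rat_frac Ef; apply: horner_neq0 da.
Qed.

(** A zero at [a] absorbs one factor [s - a] of the denominator. *)
Lemma value_at_shift a k f :
  value_at a ((('X - a%:P) ^+ k.+1)%:F * f) 0 ->
  exists c, value_at a ((('X - a%:P) ^+ k)%:F * f) c.
Proof.
move=> [n [d [da Ef n0]]]; have d0 := horner_neq0 da.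
have : root n a.
  by rewrite /root; apply/eqP; apply: (mulIf (invr_neq0 da)); rewrite -n0 mul0r.
case/factor_theorem=> q En; exists (q.[a] / d.[a]), q, d; split=> //.
apply: (@mulfI _ ('X - a%:P)%:F); first by rewrite tofrac_neq0 ?polyXsubC_eq0.
by rewrite mulrA -rmorphM -exprS Ef En rmorphM mulrA [(_%:F * q%:F)]mulrC.
Qed.

Lemma value_at_pole_order a f :
  exists k, exists c, value_at a ((('X - a%:P) ^+ k)%:F * f) c.
Proof.
have [n [d [d0 ->]]] := rat_fracP f.
have [k [e ea ->]] := multiplicity_XsubC d a.
rewrite d0 /= in ea; exists k, (n.[a] / e.[a]), n, e; split=> //.
have Xk : (('X - a%:P) ^+ k)%:F != 0 :> ratfun C.
  by rewrite tofrac_neq0 // expf_neq0 ?polyXsubC_eq0.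
by rewrite rmorphM invfM mulrCA [e%:F^-1 * _]mulrC mulVKf.
Qed.

Lemma oppr_conj_axis a : 'Re a = 0 -> - a^* = a.
Proof.
rewrite ReE => /eqP; rewrite mulf_eq0 invr_eq0 pnatr_eq0 orbF addr_eq0 => /eqP {2}->.
by [].
Qed.

End RationalFunctionTheory.

(** * Values and regularity of rational matrices *)

Section MatrixValues.
Variable C : numClosedFieldType.
Implicit Types (a : C).

Definition mx_value m n a (W : 'M[ratfun C]_(m, n)) (V : 'M[C]_(m, n)) : Prop :=
  forall i j, value_at a (W i j) (V i j).

Lemma mx_valueP m n a (W : 'M[ratfun C]_(m, n)) V :
  mx_value a W V <-> ~ mx_is_pole W a /\ mx_eval W a = V.
Proof.
split=> [WV | [nW <-] i j].
  split=> [[i [j pW]]|]; first by have /value_atP[/negP] := WV i j.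
  by apply/matrixP=> i j; rewrite mxE; have /value_atP[] := WV i j.
by apply/value_atP; rewrite mxE; split=> //; apply/negP=> pW; case: nW; exists i, j.
Qed.

Lemma mx_value_unique m n a (W : 'M[ratfun C]_(m, n)) V V' :
  mx_value a W V -> mx_value a W V' -> V = V'.
Proof. by move=> /mx_valueP[_ <-] /mx_valueP[_ <-]. Qed.

Lemma mx_value0 m n a : mx_value a (0 : 'M[ratfun C]_(m, n)) 0.
Proof. by move=> i j; rewrite !mxE; apply: value_at0. Qed.

Lemma mx_valueD m n a (W W' : 'M[ratfun C]_(m, n)) V V' :
  mx_value a W V -> mx_value a W' V' -> mx_value a (W + W') (V + V').
Proof. by move=> WV WV' i j; rewrite !mxE; apply: value_atD. Qed.

Lemma mx_valueB m n a (W W' : 'M[ratfun C]_(m, n)) V V' :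
  mx_value a W V -> mx_value a W' V' -> mx_value a (W - W') (V - V').
Proof. by move=> WV WV' i j; rewrite !mxE; apply: value_atB. Qed.

Lemma mx_valueM m n p a (W : 'M[ratfun C]_(m, n)) (W' : 'M[ratfun C]_(n, p)) V V' :
  mx_value a W V -> mx_value a W' V' -> mx_value a (W *m W') (V *m V').
Proof.
move=> WV WV' i j; rewrite !mxE; apply: value_at_sum => k; exact: value_atM.
Qed.

Lemma mx_valueZ m n a f c (W : 'M[ratfun C]_(m, n)) V :
  value_at a f c -> mx_value a W V -> mx_value a (f *: W) (c *: V).
Proof. by move=> fc WV i j; rewrite !mxE; apply: value_atM. Qed.

Lemma mx_value_tr m n a (W : 'M[ratfun C]_(m, n)) V :
  mx_value a W V -> mx_value a W^T V^T.
Proof. by move=> WV i j; rewrite !mxE; apply: WV. Qed.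

Lemma mx_value_para m n a (W : 'M[ratfun C]_(m, n)) V :
  mx_value a W V -> mx_value (- a^*) (para W) (V^t*).
Proof. by move=> WV i j; rewrite !mxE; apply/value_at_para/WV. Qed.

Lemma mx_value_const m n a (A : 'M[C]_(m, n)) : mx_value a (const_ratmx A) A.
Proof.
by move=> i j; rewrite mxE; have := value_at_tofrac a (A i j)%:P; rewrite hornerC.
Qed.

Lemma mx_value_col m1 m2 n a (W1 : 'M[ratfun C]_(m1, n)) (W2 : 'M_(m2, n)) V1 V2 :
  mx_value a W1 V1 -> mx_value a W2 V2 -> mx_value a (col_mx W1 W2) (col_mx V1 V2).
Proof. by move=> WV1 WV2 i j; rewrite !mxE; case: split => k. Qed.

Lemma mx_value_pole_order m n a (W : 'M[ratfun C]_(m, n)) :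
  exists k V, mx_value a ((('X - a%:P) ^+ k)%:F *: W) V.
Proof.
have reg i j : exists k, ~~ is_pole ((('X - a%:P) ^+ k)%:F * W i j) a.
  by have [k [c /value_atP[]]] := value_at_pole_order a (W i j); exists k.
pose K := \max_i \max_j xchoose (reg i j).
exists K, (mx_eval ((('X - a%:P) ^+ K)%:F *: W) a); apply/mx_valueP; split=> //.
case=> i [j]; apply/negP; rewrite mxE.
have le_K : (xchoose (reg i j) <= K)%N.
  apply: leq_trans (leq_bigmax (F := fun i => \max_j xchoose (reg i j)) i).
  exact: (leq_bigmax (F := fun j => xchoose (reg i j))).
rewrite -(subnK le_K) exprD rmorphM -mulrA.
have reg_k : value_at a ((('X - a%:P) ^+ xchoose (reg i j))%:F * W i j)
    (rat_eval ((('X - a%:P) ^+ xchoose (reg i j))%:F * W i j) a).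
  by apply/value_atP; split; first exact: (xchooseP (reg i j)).
by have /value_atP[] := value_atM
  (value_at_tofrac a (('X - a%:P) ^+ (K - xchoose (reg i j)))) reg_k.
Qed.

(** A rational matrix is regular at [a] as soon as the leading Laurent
   coefficient of a hypothetical pole at [a] must vanish. *)
Lemma mx_regular_of_leading0 m n a (W : 'M[ratfun C]_(m, n)) :
    (forall k V, mx_value a ((('X - a%:P) ^+ k.+1)%:F *: W) V -> V = 0) ->
  exists V, mx_value a W V.
Proof.
move=> lead0; have [k] := mx_value_pole_order a W.
elim: k => [|k IHk] [V WV]; first by rewrite expr0 rmorph1 scale1r in WV; exists V.
apply: IHk; exists (mx_eval ((('X - a%:P) ^+ k)%:F *: W) a); apply/mx_valueP.
split=> // -[i [j]]; apply/negP; rewrite mxE.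
have [|c /value_atP[]//] := @value_at_shift _ a k (W i j).
by have := WV i j; rewrite (lead0 _ _ WV) !mxE.
Qed.

Lemma value_at_polyX a k : value_at a (('X - a%:P) ^+ k.+1)%:F 0.
Proof.
by have := value_at_tofrac a (('X - a%:P) ^+ k.+1); rewrite !hornerE subrr expr0n.
Qed.

(** Left factors that are injective at [a] cancel no pole at [a]. *)
Lemma mx_regular_lfactor m n p a (A : 'M[ratfun C]_(m, n)) A0
    (W : 'M[ratfun C]_(n, p)) B0 :
    mx_value a A A0 -> (forall Y : 'M_(n, p), A0 *m Y = 0 -> Y = 0) ->
    mx_value a (A *m W) B0 ->
  exists V, mx_value a W V.
Proof.
move=> AV inj AWV; apply: mx_regular_of_leading0 => k V WV; apply: inj.
have := mx_valueZ (value_at_polyX a k) AWV; rewrite scale0r scalemxAr.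
by apply: mx_value_unique; apply: mx_valueM.
Qed.

(** The diagonal entries are squared norms of the rows. *)
Lemma mul_adj_eq0 m n (V : 'M[C]_(m, n)) : V *m V^t* = 0 -> V = 0.
Proof.
move=> VV0; apply/matrixP=> i j; rewrite mxE.
have /eqP := congr1 (fun M : 'M[C]_m => M i i) VV0.
rewrite !mxE psumr_eq0 => [/allP/(_ j)|k _]; last by rewrite !mxE mul_conjC_ge0.
by rewrite mem_index_enum !mxE mul_conjC_eq0 => /(_ isT)/eqP.
Qed.

(** On the imaginary axis the leading Laurent coefficient of [W *m para W] is,
   up to sign, the Gram matrix of that of [W], so it cannot vanish. *)
Lemma mx_regular_axis m n a (W : 'M[ratfun C]_(m, n)) B0 :
  'Re a = 0 -> mx_value a (W *m para W) B0 -> exists V, mx_value a W V.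
Proof.
move=> a_im WWV; apply: mx_regular_of_leading0 => k V WV; apply: mul_adj_eq0.
have := mx_value_para WV; rewrite (oppr_conj_axis a_im) => /(mx_valueM WV) WWV'.
apply: mx_value_unique WWV' _; rewrite -scalemxAl.
have E : para ((('X - a%:P) ^+ k.+1)%:F *: W) =
    (para_poly (('X - a%:P) ^+ k.+1))%:F *: para W.
  by apply/matrixP=> i j; rewrite !mxE rmorphM /= para_rat_tofrac.
rewrite E -scalemxAr -(scale0r ((para_poly (('X - a%:P) ^+ k.+1)).[a] *: B0)).
apply: mx_valueZ (value_at_polyX a k) _.
exact: mx_valueZ (value_at_tofrac _ _) WWV.
Qed.
End MatrixValues.

(** * Spectral products: definiteness, properness, constants *)

Section SpectralProducts.
Variable C : numClosedFieldType.
Implicit Types (a : C) (f : ratfun C).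

Lemma paraM m n p (A : 'M[ratfun C]_(m, n)) (B : 'M_(n, p)) :
  para (A *m B) = para B *m para A.
Proof. by rewrite /para trmx_mul map_mxM. Qed.

Lemma paraK m n (A : 'M[ratfun C]_(m, n)) : para (para A) = A.
Proof. by apply/matrixP=> i j; rewrite !mxE para_ratK. Qed.

Lemma para1 n : para (1%:M : 'M[ratfun C]_n) = 1%:M.
Proof. by rewrite /para trmx1 map_mx1. Qed.

Lemma para_const m n (A : 'M[C]_(m, n)) : para (const_ratmx A) = const_ratmx (A^t*).
Proof.
apply/matrixP=> i j; rewrite !mxE para_rat_tofrac /para_poly map_polyC comp_polyC.
by [].
Qed.

Lemma const_ratmxE m n (A : 'M[C]_(m, n)) :
  const_ratmx A = map_mx (@FracField.tofrac {poly C} \o @polyC C) A.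
Proof. by []. Qed.

Lemma const_ratmxM m n p (A : 'M[C]_(m, n)) (B : 'M_(n, p)) :
  const_ratmx (A *m B) = const_ratmx A *m const_ratmx B.
Proof. by rewrite !const_ratmxE map_mxM. Qed.

Lemma const_ratmxD m n (A B : 'M[C]_(m, n)) :
  const_ratmx (A + B) = const_ratmx A + const_ratmx B.
Proof. by rewrite !const_ratmxE map_mxD. Qed.

Lemma const_ratmxN m n (A : 'M[C]_(m, n)) :
  const_ratmx (- A) = - const_ratmx A.
Proof. by rewrite !const_ratmxE map_mxN. Qed.

Lemma const_ratmx1 n : const_ratmx (1%:M : 'M[C]_n) = 1%:M.
Proof. by rewrite !const_ratmxE map_mx1. Qed.

Lemma const_ratmx_inj m n : injective (@const_ratmx C m n).
Proof.
move=> A B E; apply: (mx_value_unique (a := 0) (mx_value_const 0 A)).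
by rewrite E; apply: mx_value_const.
Qed.

(** A nonzero rational function has finitely many zeros, and the imaginary axis
   is infinite. *)
Lemma rat_eq0_on_axis f :
  (forall a c, 'Re a = 0 -> value_at a f c -> c = 0) -> f = 0.
Proof.
move=> f0; rewrite (rat_numden f); set n := rat_num f; set d := rat_den f.
have d0 : d != 0 by apply: rat_den_neq0.
suff : n * d = 0.
  by move/eqP; rewrite mulf_eq0 (negPf d0) orbF => /eqP->; rewrite rmorph0 mul0r.
pose rs := [seq 'i * k%:R : C | k <- iota 0 (size (n * d))].
apply: (@roots_geq_poly_eq0 _ _ rs); last by rewrite size_map size_iota.
  apply/allP=> _ /mapP[k _ ->]; rewrite rootM; apply/orP.
  have [rd|rd] := boolP (root d ('i * k%:R)); [by right | left].
  have im_k : 'Re ('i * k%:R : C) = 0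
    by rewrite mulrC ReMir (Creal_ImP _ (realn _ k)) oppr0.
  have fk : value_at ('i * k%:R) f (n.['i * k%:R] / d.['i * k%:R]).
    by exists n, d; split=> //; apply: rat_numden.
  have /eqP := f0 _ _ im_k fk.
  by rewrite mulf_eq0 invr_eq0 -![_ == 0]/(root _ _) (negPf rd) orbF.
rewrite map_inj_uniq ?iota_uniq // => k l /(mulfI (neq0Ci _)) /eqP.
by rewrite eqr_nat => /eqP.
Qed.

(** [W *m para W] is a sum of squared moduli on the imaginary axis. *)
Lemma mul_para_eq0 m n (W : 'M[ratfun C]_(m, n)) : W *m para W = 0 -> W = 0.
Proof.
move=> WW0; apply/matrixP=> i j; rewrite mxE; apply: rat_eq0_on_axis => a c a_im Wc.
have WWV : mx_value a (W *m para W) 0 by rewrite WW0; apply: mx_value0.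
have [V WV] := mx_regular_axis a_im WWV.
have := mx_value_para WV; rewrite (oppr_conj_axis a_im) => /(mx_valueM WV) WWV'.
have V0 := mul_adj_eq0 (mx_value_unique WWV' WWV).
by rewrite (value_at_unique Wc (WV i j)) V0 mxE.
Qed.

Lemma mxrank_mul_para m n (W : 'M[ratfun C]_(m, n)) : \rank (W *m para W) = \rank W.
Proof.
rewrite -[RHS](mxrank_mul_ker W (para W)).
suff -> : (W :&: kermx (para W))%MS = 0 by rewrite mxrank0 addn0.
set K := (_ :&: _)%MS.
have /submxP[Z EZ] : (K <= W)%MS by apply: capmxSl.
have /sub_kermxP K0 : (K <= kermx (para W))%MS by apply: capmxSr.
by apply: mul_para_eq0; rewrite {2}EZ paraM mulmxA K0 mul0mx.
Qed.

(** Hermitian symmetry on the axis propagates to an identity of rational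
   matrices. *)
Lemma spectral_density_para n (Phi : 'M[ratfun C]_n) :
  spectral_density Phi -> para Phi = Phi.
Proof.
move=> [_ hPhi]; apply/eqP; rewrite -subr_eq0; apply/eqP/matrixP=> i j.
rewrite [RHS]mxE; apply: rat_eq0_on_axis => a c a_im vc.
have [reg herm _] := hPhi a a_im.
have PV : mx_value a Phi (mx_eval Phi a) by apply/mx_valueP.
have := mx_value_para PV; rewrite (oppr_conj_axis a_im) => /mx_valueB/(_ PV) PV'.
rewrite (value_at_unique vc (PV' i j)).
move: herm; rewrite is_hermitianmxE expr0 scale1r => /eqP <-.
by rewrite subrr mxE.
Qed.

(** The fraction need not be reduced. *)
Lemma proper_rat_frac f (n d : {poly C}) :
  d != 0 -> f = n%:F / d%:F -> proper_rat f = (size n <= size d)%N.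
Proof.
move=> d0 Ef; have den0 := rat_den_neq0 f.
have /eqP E : n * rat_den f == rat_num f * d.
  by rewrite -tofrac_div_eq // -Ef -rat_numden.
rewrite /proper_rat; have [n0|n0] := eqVneq n 0.
  have /eqP: rat_num f * d = 0 by rewrite -E n0 mul0r.
  by rewrite mulf_eq0 (negPf d0) orbF n0 => /eqP->; rewrite size_poly0.
have num0 : rat_num f != 0.
  by apply: contra_neq (mulf_neq0 n0 den0) => num0; rewrite E num0 mul0r.
have /(congr1 succn) := congr1 (size \o @polyseq C) E.
rewrite /= !size_mul // !prednK ?addn_gt0 ?lt0n ?size_poly_eq0 ?n0 ?num0 // => Es.
by rewrite -(leq_add2r (size d)) -Es [X in (_ <= X)%N]addnC leq_add2r.
Qed.

Lemma common_denominator n (f : 'I_n -> ratfun C) :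
  exists (d : {poly C}) (q : 'I_n -> {poly C}),
    d != 0 /\ forall j, f j = (q j)%:F / d%:F.
Proof.
exists (\prod_j rat_den (f j)).
exists (fun j => rat_num (f j) * \prod_(i | i != j) rat_den (f i)).
split=> [|j]; first by apply/prodf_neq0=> j _; apply: rat_den_neq0.
rewrite [LHS]rat_numden; apply/eqP; rewrite tofrac_div_eq ?rat_den_neq0 //; last first.
  by apply/prodf_neq0=> k _; apply: rat_den_neq0.
by rewrite [X in _ * X](bigD1 j) //= mulrA mulrAC.
Qed.

Lemma coefM_top (p q : {poly C}) k :
  (size p <= k.+1)%N -> (size q <= k.+1)%N -> (p * q)`_(k + k) = p`_k * q`_k.
Proof.
move=> sp sq; rewrite coefM.
have lt_k : (k < (k + k).+1)%N by rewrite ltnS leq_addr.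
rewrite (bigD1 (Ordinal lt_k)) //= addnK big1 ?addr0 // => i ne_ik.
have [lt_ik|le_ki] := ltnP i k; last first.
  rewrite nth_default ?mul0r // (leq_trans sp) // ltn_neqAle le_ki andbT.
  by rewrite eq_sym; exact: ne_ik.
rewrite [X in _ * X](nth_default 0) ?mulr0 //; apply: leq_trans sq _.
by rewrite ltn_subRL ltn_add2r.
Qed.

(** The leading coefficients in [W *m para W] are squared norms, up to a common
   sign, so the highest degree cannot cancel. *)
Lemma mx_proper_of_mul_para m n (W : 'M[ratfun C]_(m, n)) :
  mx_proper (W *m para W) -> mx_proper W.
Proof.
move=> WWp i; have [d [q [d0 Eq]]] := common_denominator (W i).
have size_dd : (size (d * para_poly d)%R <= (size d + size d).-1)%N.
  by rewrite (leq_trans (size_polyMleq _ _)) ?size_para_poly.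
have dd0 : d * para_poly d != 0 by rewrite mulf_neq0 ?para_poly_eq0.
have ds : (0 < size d)%N by rewrite lt0n size_poly_eq0.
have EWW : (W *m para W) i i =
    (\sum_j q j * para_poly (q j))%:F / (d * para_poly d)%:F.
  rewrite mxE rmorph_sum mulr_suml; apply: eq_bigr => j _; rewrite !mxE Eq.
  by rewrite (para_rat_frac d0 erefl) mulf_div -!rmorphM.
have := WWp i i; rewrite (proper_rat_frac dd0 EWW) => /leq_trans/(_ size_dd) size_qq.
suff size_q k : (forall j, (size (q j) <= size d + k)%N) ->
    forall j, (size (q j) <= size d)%N.
  move=> j; rewrite (proper_rat_frac d0 (Eq j)).
  apply: (size_q (\max_j size (q j))) => l.
  by rewrite (leq_trans _ (leq_addl _ _)) // (leq_bigmax (F := fun l => size (q l))).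
elim: k => [|k IHk] qk; first by move=> j; rewrite -[X in (_ <= X)%N]addn0.
apply: IHk => j; apply/leq_sizeP => l; rewrite leq_eqVlt => /orP[/eqP <-|lt_l];
  last by apply: nth_default; rewrite (leq_trans (qk j)) // addnS.
set N := (size d + k)%N.
have /eqP : (\sum_j q j * para_poly (q j))`_(N + N) = 0.
  apply: nth_default; apply: leq_trans size_qq _.
  by rewrite (leq_trans (leq_pred _)) // leq_add ?leq_addr.
rewrite coef_sum (eq_bigr (fun j => (-1) ^+ N * ((q j)`_N * ((q j)`_N)^*))); last first.
  move=> s _; rewrite coefM_top ?size_para_poly -?addnS //.
  by rewrite coef_para_poly mulrCA.
rewrite -mulr_sumr mulf_eq0 signr_eq0 psumr_eq0 /= => [/allP/(_ j)|s _]; last first.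
  exact: mul_conjC_ge0.
by rewrite mem_index_enum mul_conjC_eq0 => /(_ isT)/eqP.
Qed.

(** Liouville's theorem for rational functions: a denominator without roots is
   constant, and properness then bounds the numerator. *)
Lemma const_ratmx_of_regular m n (W : 'M[ratfun C]_(m, n)) :
  mx_proper W -> (forall a, exists V, mx_value a W V) -> exists K, W = const_ratmx K.
Proof.
move=> Wp Wreg.
have Wc i j : exists c, W i j == (c%:P)%:F.
  have /eqP sd : size (rat_den (W i j)) == 1.
    apply: contraT => /closed_rootP[a ra]; have [V /(_ i j)] := Wreg a.
    by case/value_atP; rewrite /is_pole ra.
  have := Wp i j; rewrite /proper_rat sd => /size1_polyC En.
  have Ed := size1_polyC (eq_leq sd).
  have d0 := rat_den_neq0 (W i j).
  rewrite (rat_numden (W i j)); set n1 := (rat_num _)`_0 in En.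
  set d1 := (rat_den _)`_0 in Ed; exists (n1 / d1).
  rewrite En Ed; rewrite Ed polyC_eq0 in d0.
  rewrite -[X in _ == X]divr1 -(rmorph1 (@FracField.tofrac {poly C})).
  by rewrite tofrac_div_eq ?polyC_eq0 ?oner_eq0 // mulr1 -polyCM mulfVK.
exists (\matrix_(i, j) xchoose (Wc i j)).
by apply/matrixP=> i j; rewrite !mxE; apply/eqP; exact: (xchooseP (Wc i j)).
Qed.

(** * Uniqueness of minimum-phase factors *)

(** Stated for matrices [Y] rather than vectors, as injectivity is applied to
   matrix Laurent coefficients. *)
Lemma minimum_phase_inj m n p (W : 'M[ratfun C]_(m, n)) a : minimum_phase W ->
  0 < 'Re a -> exists V, mx_value a W V /\ forall Y : 'M_(n, p), V *m Y = 0 -> Y = 0.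
Proof.
move=> [_ poles zeros] a_gt0; exists (mx_eval W a).
have reg : ~ mx_is_pole W a.
  by move/poles => /lt_trans/(_ a_gt0); rewrite ltxx.
split; first exact/mx_valueP.
move=> Y WY0; apply/matrixP=> i j; rewrite mxE; apply/eqP/contraT => Yij.
suff /zeros : is_zero W a by rewrite real_leNgt ?a_gt0 // Creal_Re.
split=> //; exists (col j Y); last by rewrite colE mulmxA WY0 mul0mx.
by apply: contraNneq Yij => /matrixP/(_ i 0); rewrite !mxE => ->.
Qed.

(** The comparison matrix [U] is all-pass; poles in the right half plane are
   excluded by injectivity of [W'], poles in the left one by exchanging [W] and
   [W'], which turns [U] into [para U]. *)
Lemma minimum_phase_factor_unique n r r' (Phi : 'M[ratfun C]_n)
    (W : 'M_(n, r)) (W' : 'M_(n, r')) :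
    spectral_factor Phi W -> minimum_phase W -> \rank W = r ->
    spectral_factor Phi W' -> minimum_phase W' -> \rank W' = r' ->
  exists (e : r = r') (K : 'M[C]_r'),
    K \is unitarymx /\ castmx (erefl n, e) W = W' *m const_ratmx K.
Proof.
move=> EW mpW rW EW' mpW' rW'.
have e : r = r' by rewrite -rW -rW' -mxrank_mul_para -EW EW' mxrank_mul_para.
exists e; case: _ / e W' EW' mpW' rW' => W' EW' mpW' rW'; rewrite castmx_id.
(* Both factors have the column space of [Phi]. *)
have [U EU] : exists U, W = W' *m U.
  have sub V : spectral_factor Phi V -> (Phi^T <= V^T)%MS.
    by move=> ->; rewrite trmx_mul submxMl.
  have : (W^T <= Phi^T)%MS.
    have [_ <-] := mxrank_leqif_sup (sub _ _ EW).
    by rewrite !mxrank_tr EW mxrank_mul_para.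
  move/submx_trans/(_ (sub _ _ EW'))/submxP => [Z EZ]; exists Z^T.
  by rewrite -[W]trmxK EZ trmx_mul trmxK.
have /row_fullP[L LW'] : row_full W' by rewrite /row_full rW'.
have UU1 : U *m para U = 1%:M.
  have paraLW' : para W' *m para L = 1%:M by rewrite -paraM LW' para1.
  have : W' *m para W' = W' *m U *m (para U *m para W').
    by rewrite -paraM -EU -EW' -EW.
  move/(congr1 (fun X => L *m X *m para L)).
  by rewrite !mulmxA LW' -!mulmxA paraLW' !mulmx1 !mul1mx => <-.
have rhp (V V' : 'M[ratfun C]_(n, r)) Y a :
    minimum_phase V -> minimum_phase V' -> V = V' *m Y -> 0 < 'Re a -> exists Y0, mx_value a Y Y0.
  move=> mpV mpV' E a_gt0.
  have [V0 [VV0 _]] := minimum_phase_inj r mpV a_gt0.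
  have [V1 [VV1 inj]] := minimum_phase_inj r mpV' a_gt0.
  by apply: mx_regular_lfactor VV1 inj _; rewrite -E; apply: VV0.
have [K EK] : exists K, U = const_ratmx K.
  apply: const_ratmx_of_regular.
    apply: mx_proper_of_mul_para; rewrite UU1 => i j; rewrite mxE.
    rewrite (@proper_rat_frac _ (i == j)%:R 1) ?oner_eq0 //.
      by rewrite size_poly1; case: (i == j); rewrite ?size_poly1 ?size_poly0.
    by rewrite divr1 rmorph_nat.
  move=> a; have [a_gt0|a_lt0|a_im] := real_ltgtP (real0 C) (Creal_Re a).
  - exact: rhp mpW mpW' EU a_gt0.
  - have EU' : W' = W *m para U by rewrite EU -mulmxA UU1 mulmx1.
    have [|V] := rhp _ _ _ (- a^*) mpW' mpW EU'.
      by rewrite raddfN /= Re_conj oppr_gt0.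
    move/mx_value_para; rewrite paraK rmorphN /= conjCK opprK => UV.
    by exists (V^t*).
  - apply: (@mx_regular_axis _ _ _ _ _ 1%:M); first by rewrite a_im.
    by rewrite UU1 -const_ratmx1; apply: mx_value_const.
exists K; split; last by rewrite EU EK.
apply/unitarymxP/const_ratmx_inj.
by rewrite const_ratmxM -para_const -EK UU1 const_ratmx1.
Qed.
End SpectralProducts.

(** * State-space realizations *)

(** The cross term of the product telescopes by the second resolvent identity
   [invmx Z' *m (Z - Z') *m invmx Z = invmx Z' - invmx Z]. *)
Lemma output_injection_identity (F : fieldType) k m n (Z Z' : 'M[F]_n)
    (l : 'M_(n, k)) (c : 'M_(k, n)) (b : 'M_(n, m)) (d : 'M_(k, m)) :
  Z \in unitmx -> Z' \in unitmx -> l *m c = Z - Z' ->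
  (c *m invmx Z' *m l + 1%:M) *m (c *m invmx Z *m b + d) =
  c *m invmx Z' *m (b + l *m d) + d.
Proof.
move=> uZ uZ' Elc.
have cross : c *m invmx Z' *m l *m (c *m invmx Z *m b) =
    c *m invmx Z' *m b - c *m invmx Z *m b.
  rewrite -!mulmxA -mulmxBr; congr (_ *m _).
  by rewrite [l *m _]mulmxA Elc mulmxBl mulKVmx // mulmxBr mulKmx.
rewrite mulmxDl mul1mx !mulmxDr cross !mulmxA -!addrA; congr (_ + _).
by rewrite addrCA addKr.
Qed.

(** The hypothesis turns the quadratic term of the product into the sum of the
   two linear ones. *)
Lemma allpass_identity (F : fieldType) k n (Z Z' y : 'M[F]_n)
    (c : 'M_(k, n)) (c' : 'M_(n, k)) :
    Z \in unitmx -> Z' \in unitmx -> y *m Z' + Z *m y = y *m c' *m c *m y ->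
  (1%:M - c *m invmx Z *m (y *m c')) *m (1%:M - c *m y *m invmx Z' *m c') = 1%:M.
Proof.
move=> uZ uZ' E.
have cross : c *m invmx Z *m (y *m c') *m (c *m y *m invmx Z' *m c') =
    c *m invmx Z *m (y *m c') + c *m y *m invmx Z' *m c'.
  have -> : c *m invmx Z *m (y *m c') *m (c *m y *m invmx Z' *m c') =
      c *m (invmx Z *m (y *m c' *m c *m y) *m invmx Z') *m c' by rewrite !mulmxA.
  rewrite -E mulmxDr mulKmx // mulmxDl !mulmxA mulmxK // mulmxDr mulmxDl.
  by rewrite !mulmxA.
rewrite mulmxBl mul1mx mulmxBr mulmx1 cross opprB [X in _ + (X - _)]addrC addrK.
exact: subrK.
Qed.

Section Realizations.
Variable C : numClosedFieldType.
Implicit Types (a : C).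

Definition pencil n (A : 'M[C]_n) : 'M[ratfun C]_n :=
  ('X : {poly C})%:F%:M - const_ratmx A.

(** The determinant of the pencil is the characteristic polynomial. *)
Lemma unitmx_pencil n (A : 'M[C]_n) : pencil A \in unitmx.
Proof.
have -> : pencil A = map_mx (@FracField.tofrac {poly C}) (char_poly_mx A).
  by rewrite /char_poly_mx map_mxB map_scalar_mx -map_mx_comp.
rewrite unitmxE det_map_mx unitfE tofrac_eq0.
exact/monic_neq0/char_poly_monic.
Qed.

Lemma mx_value_pencil n a (A : 'M[C]_n) : mx_value a (pencil A) (a%:M - A).
Proof.
apply: mx_valueB (mx_value_const a A) => i j; rewrite !mxE.
have := value_at_tofrac a (if i == j then 'X else 0).
by case: (i == j); rewrite ?hornerX // horner0 rmorph0.
Qed.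

Lemma mx_value_invmx n a (W : 'M[ratfun C]_n) V :
  W \in unitmx -> V \in unitmx -> mx_value a W V -> mx_value a (invmx W) (invmx V).
Proof.
move=> Wu Vu WV; have W1 : mx_value a (W *m invmx W) 1%:M.
  by rewrite mulmxV // -const_ratmx1; apply: mx_value_const.
have [V' WV'] : exists V', mx_value a (invmx W) V'.
  apply: mx_regular_lfactor WV _ W1 => Y VY0.
  by rewrite -[Y](mulKmx Vu) VY0 mulmx0.
suff <- : V' = invmx V by [].
have /(canRL (mulKmx Vu)) -> : V *m V' = 1%:M.
  exact: mx_value_unique (mx_valueM WV WV') W1.
by rewrite mulmx1.
Qed.

Lemma mx_value_realization k m n a (A : 'M[C]_n) (B : 'M_(n, m)) (Co : 'M_(k, n)) D :
  a%:M - A \in unitmx ->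
  mx_value a (realization A B Co D) (Co *m invmx (a%:M - A) *m B + D).
Proof.
move=> Au; apply: mx_valueD (mx_value_const a D).
apply: mx_valueM (mx_value_const a B); apply: mx_valueM (mx_value_const a Co) _.
by apply: mx_value_invmx (unitmx_pencil A) Au _; apply: mx_value_pencil.
Qed.

(** Read from left to right with [K] injective, the equation restricts a
   realization to the invariant subspace spanned by the columns of [K]; read
   from right to left with [K] surjective, it passes to a quotient of the state
   space. *)
Lemma realization_intertwine k m n n' (A : 'M[C]_n) (A' : 'M_n') (K : 'M_(n, n'))
    (B : 'M_(n', m)) (Co : 'M_(k, n)) D :
  A *m K = K *m A' -> realization A (K *m B) Co D = realization A' B (Co *m K) D.
Proof.
move=> AK; rewrite /realization -!/(pencil _) !const_ratmxM; congr (_ + _).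
rewrite !mulmxA; congr (_ *m _); rewrite -!mulmxA; congr (_ *m _).
apply: (canLR (mulKmx (unitmx_pencil A))); rewrite mulmxA.
apply: (canRL (mulmxK (unitmx_pencil A'))).
by rewrite mulmxBr mulmxBl -!const_ratmxM AK scalar_mxC.
Qed.

Lemma realization_tr k m n (A : 'M[C]_n) (B : 'M_(n, m)) (Co : 'M_(k, n)) D :
  (realization A B Co D)^T = realization A^T Co^T B^T D^T.
Proof.
rewrite /realization linearD /= !trmx_mul trmx_inv linearB /= tr_scalar_mx mulmxA.
by rewrite /const_ratmx !map_trmx.
Qed.

Lemma minimal_realization_tr k m n (F : 'M[ratfun C]_(k, m)) (A : 'M[C]_n)
    (B : 'M_(n, m)) (Co : 'M_(k, n)) D :
  minimal_realization F A B Co D -> minimal_realization F^T A^T Co^T B^T D^T.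
Proof.
move=> [-> minA]; split=> [|n' A' B' C' D']; first by rewrite realization_tr.
move/(congr1 trmx); rewrite trmxK realization_tr; exact: minA.
Qed.

(** An unobservable invariant subspace can be quotiented out of the state space,
   which shortens the realization. *)
Lemma minimal_observable k m n l (F : 'M[ratfun C]_(k, m)) (A : 'M[C]_n)
    (B : 'M_(n, m)) (Co : 'M_(k, n)) D (V : 'M_(n, l)) E :
  minimal_realization F A B Co D -> A *m V = V *m E -> Co *m V = 0 -> V = 0.
Proof.
move=> [EF minA] AV CV; pose N := row_base (kermx V).
have NV : N *m V = 0 by apply/sub_kermxP; rewrite eq_row_base.
have subN q (Y : 'M_(q, n)) : Y *m V = 0 -> exists Z, Y = Z *m N.
  by move/sub_kermxP; rewrite -(eq_row_base (kermx V)) => /submxP.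
have [C' EC] := subN _ _ CV.
have [A' EA] : exists A', N *m A = A' *m N.
  by apply: subN; rewrite -mulmxA AV mulmxA NV mul0mx.
have : F = realization A' (N *m B) C' D.
  by rewrite EF EC; apply/esym; apply: realization_intertwine.
move/minA.
rewrite mxrank_ker => le_n; apply/eqP; rewrite -mxrank_eq0.
have [//|V0] := eqVneq (\rank V) 0%N.
have lt_n : (n - \rank V < n)%N.
  by rewrite ltn_subrL lt0n V0 (leq_trans _ (rank_leq_row V)) // lt0n.
by rewrite leqNgt lt_n in le_n.
Qed.

Lemma minimal_controllable k m n l (F : 'M[ratfun C]_(k, m)) (A : 'M[C]_n)
    (B : 'M_(n, m)) (Co : 'M_(k, n)) D (V : 'M_(l, n)) E :
  minimal_realization F A B Co D -> V *m A = E *m V -> V *m B = 0 -> V = 0.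
Proof.
move=> /minimal_realization_tr minA VA VB; apply/trmx_inj; rewrite trmx0.
by apply: (minimal_observable (E := E^T) minA);
  rewrite -trmx_mul ?VA ?VB ?trmx0 ?trmx_mul.
Qed.

Lemma realization_mul_const k l m n (A : 'M[C]_n) (B : 'M_(n, m)) (Co : 'M_(k, n)) D
    (P : 'M_(l, k)) :
  const_ratmx P *m realization A B Co D = realization A B (P *m Co) (P *m D).
Proof. by rewrite /realization mulmxDr !const_ratmxM !mulmxA. Qed.

(** The inverse of the first factor has [A] as state matrix, so the product
   trades the poles of [A] for those of [A + L *m Co] without adding states. *)
Lemma realization_output_injection k m n (A : 'M[C]_n) (B : 'M_(n, m))
    (Co : 'M_(k, n)) D (L : 'M_(n, k)) :
  realization (A + L *m Co) L Co 1%:M *m realization A B Co D =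
  realization (A + L *m Co) (B + L *m D) Co D.
Proof.
rewrite /realization -!/(pencil _) const_ratmx1 const_ratmxD const_ratmxM.
apply: output_injection_identity; try exact: unitmx_pencil.
by rewrite /pencil const_ratmxD const_ratmxM opprB !addrA subrK addrAC subrr add0r.
Qed.

(** The input reaches the first block of states only. *)
Lemma realization_ublock k m n1 n2 (A1 : 'M[C]_n1) A2 (A3 : 'M_n2) (B : 'M_(n1, m))
    (C1 : 'M_(k, n1)) (C2 : 'M_(k, n2)) D :
  realization (block_mx A1 A2 0 A3) (col_mx B 0) (row_mx C1 C2) D =
  realization A1 B C1 D.
Proof.
have -> : col_mx B 0 = col_mx 1%:M (0 : 'M_(n2, n1)) *m B.
  by rewrite mul_col_mx mul1mx mul0mx.
rewrite (@realization_intertwine _ _ _ _ _ A1).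
  by rewrite mul_row_col mulmx1 mulmx0 addr0.
by rewrite mul_block_col mul_col_mx !mulmx0 !mulmx1 mul1mx !mul0mx !addr0.
Qed.

Lemma unitmx_eigenvalue n (A : 'M[C]_n) a : (a%:M - A \in unitmx) = ~~ eigenvalue A a.
Proof.
rewrite /eigenvalue /eigenspace kermx_eq0 row_free_unit negbK.
by rewrite -opprB -scaleN1r unitmxZ // unitrN1.
Qed.

Lemma eigenvalue_adj n (A : 'M[C]_n) a : eigenvalue (A^t*) a = eigenvalue A (a^*).
Proof.
apply: negb_inj; rewrite -!unitmx_eigenvalue -unitmx_tr -(map_unitmx Num.conj).
by rewrite linearB /= map_mxB tr_scalar_mx map_scalar_mx /= map_trmx trmxK
  -map_mx_comp map_mx_id // => x /=; rewrite conjCK.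
Qed.

Lemma eigenvalueN n (A : 'M[C]_n) a : eigenvalue (- A) a = eigenvalue A (- a).
Proof.
apply: negb_inj; rewrite -!unitmx_eigenvalue opprK.
have -> : a%:M + A = -1 *: ((- a)%:M - A).
  by rewrite scaleN1r opprB raddfN opprK addrC.
by rewrite unitmxZ // unitrN1.
Qed.

Lemma unitmx_ublock n1 n2 (A1 : 'M[C]_n1) A2 (A3 : 'M_n2) a :
  a%:M - A1 \in unitmx -> a%:M - A3 \in unitmx ->
  a%:M - block_mx A1 A2 0 A3 \in unitmx.
Proof.
move=> u1 u3; rewrite scalar_mx_block opp_block_mx add_block_mx oppr0 addr0.
by rewrite unitmxE det_ublock unitrM -!unitmxE u1 u3.
Qed.
End Realizations.

(** * The Lyapunov equation *)

Section Lyapunov.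
Variable C : numClosedFieldType.
Implicit Types (a : C).

Lemma adjM m n p (A : 'M[C]_(m, n)) (B : 'M_(n, p)) :
  (A *m B)^t* = B^t* *m A^t*.
Proof. by rewrite trmx_mul map_mxM. Qed.

Lemma adjK m n (A : 'M[C]_(m, n)) : A^t*^t* = A.
Proof. by apply/matrixP=> i j; rewrite !mxE conjCK. Qed.

(** [X] intertwines [q(A)] and [q(B)] for every polynomial [q]; for the
   characteristic polynomial of [A] the former vanishes and the latter is
   invertible. *)
Lemma sylvester_inj m n (A : 'M[C]_n) (B : 'M_m) (X : 'M_(m, n)) :
  (forall a, eigenvalue A a -> ~~ eigenvalue B a) -> X *m A = B *m X -> X = 0.
Proof.
case: n A X => [|n] A X; first by move=> _ _; apply/matrixP=> i [].
case: m B X => [|m] B X; first by move=> _ _; apply/matrixP=> [[]].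
move=> disj XA.
have Xp (q : {poly C}) : X *m horner_mx A q = horner_mx B q *m X.
  elim/poly_ind: q => [|q c IHq]; first by rewrite !rmorph0 mulmx0 mul0mx.
  rewrite !rmorphD !rmorphM /= !horner_mx_X !horner_mx_C mulmxDr mulmxDl.
  by rewrite -scalar_mxC -!mulmxE mulmxA IHq -!mulmxA XA.
have [rs Ep] := closed_field_poly_normal (char_poly A).
rewrite (monicP (char_poly_monic A)) scale1r in Ep.
have u : horner_mx B (char_poly A) \in unitmx.
  rewrite Ep big_seq rmorph_prod /=; apply: (big_ind (fun Y => Y \in unitmx)).
  - exact: unitmx1.
  - by move=> Y Z Yu Zu; rewrite -mulmxE unitmx_mul Yu.
  move=> a ra; rewrite rmorphB /= horner_mx_X horner_mx_C -opprB -scaleN1r.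
  rewrite unitmxZ ?unitrN1 // unitmx_eigenvalue; apply: disj.
  by rewrite eigenvalue_root_char Ep root_prod_XsubC.
have := Xp (char_poly A); rewrite Cayley_Hamilton mulmx0 => E.
by rewrite -[X](mulKmx u) -E mulmx0.
Qed.

Section Solution.
Variables (n : nat) (A : 'M[C]_n).
Hypothesis A_unstable : forall a, eigenvalue A a -> 0 < 'Re a.

(** The spectra of [A] and of its mirror image lie in opposite half planes. *)
Lemma lyapunov_inj (X : 'M_n) : A^t* *m X + X *m A = 0 -> X = 0.
Proof.
move/eqP; rewrite addrC addr_eq0 -mulNmx => /eqP XA; apply: sylvester_inj XA => a Aa.
rewrite eigenvalueN eigenvalue_adj; apply/negP => /A_unstable.
by rewrite Re_conj raddfN oppr_gt0 => /lt_trans/(_ (A_unstable Aa)); rewrite ltxx.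
Qed.

Lemma lyapunov_exists (Q : 'M_n) : exists X : 'M_n, A^t* *m X + X *m A = Q.
Proof.
pose f := (mulmx (A^t*) \+ mulmxr A) : 'M[C]_n -> 'M[C]_n.
have fE X : f X = A^t* *m X + X *m A by [].
have u : lin_mx f \in unitmx.
  rewrite -row_free_unit -kermx_eq0; apply/eqP/row_matrixP => i; rewrite row0.
  have : row i (kermx (lin_mx f)) *m lin_mx f = 0.
    by rewrite -row_mul mulmx_ker row0.
  rewrite -[row i _]vec_mxK (mul_vec_lin (mulmx (A^t*) \+ mulmxr A)) -(raddf0 mxvec).
  by move/(can_inj mxvecK)/lyapunov_inj => ->.
exists (vec_mx (mxvec Q *m invmx (lin_mx f))); rewrite -fE.
apply: (can_inj mxvecK).
by rewrite -(mul_vec_lin (mulmx (A^t*) \+ mulmxr A)) vec_mxK mulmxKV.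
Qed.

Variables (k : nat) (Co : 'M[C]_(k, n)).
Hypothesis observable : forall l (V : 'M[C]_(n, l)) E,
  A *m V = V *m E -> Co *m V = 0 -> V = 0.

(** The adjoint of a solution is a solution, so uniqueness makes it Hermitian.
   Its kernel is invariant under [A] and contained in the kernel of [Co]:
   sandwich the equation between a kernel vector and its adjoint, then multiply
   it by a kernel vector. So observability makes it invertible. *)
Lemma lyapunov_exists_unique : exists! X, lyapunov_solution A Co X.
Proof.
have [X EX] := lyapunov_exists (Co^t* *m Co).
have uniqX Y : A^t* *m Y + Y *m A = Co^t* *m Co -> X = Y.
  move=> EY; apply/eqP; rewrite -subr_eq0; apply/eqP/lyapunov_inj.
  by rewrite mulmxBr mulmxBl addrACA -opprD EX EY subrr.
have hX : X^t* = X.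
  apply/esym/uniqX.
  have := congr1 (fun Y : 'M[C]_n => Y^t*) EX.
  by rewrite /= linearD map_mxD -!/(_^t*) !adjM !adjK addrC.
exists X; split=> [|Y [_ _ /eqP]]; last by rewrite subr_eq0 => /eqP/uniqX.
split; last by rewrite EX subrr.
  by rewrite is_hermitianmxE expr0 scale1r hX.
pose V := kermx X; have VX : V *m X = 0 by apply: mulmx_ker.
have XV : X *m V^t* = 0 by rewrite -{1}hX -adjM VX trmx0 map_mx0.
have VAX : V *m A^t* *m X = V *m Co^t* *m Co.
  have := congr1 (mulmx V) EX.
  by rewrite mulmxDr !mulmxA VX mul0mx addr0.
have VC : V *m Co^t* = 0.
  apply: mul_adj_eq0; by rewrite adjM adjK mulmxA -VAX -[LHS]mulmxA XV mulmx0.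
have /submxP[E EV] : (V *m A^t* <= V)%MS.
  by apply/sub_kermxP; rewrite VAX VC mul0mx.
rewrite -row_free_unit -kermx_eq0 -/V -[V]adjK.
rewrite (observable (V := V^t*) (E := E^t*)) ?trmx0 ?map_mx0 //.
  by rewrite -[A in LHS]adjK -!adjM EV.
by rewrite -[Co]adjK -adjM VC trmx0 map_mx0.
Qed.
End Solution.

(** * The all-pass factor *)

Section AllPass.
Variables (n k : nat) (A : 'M[C]_n) (Co : 'M[C]_(k, n)) (X : 'M[C]_n).
Hypothesis solX : lyapunov_solution A Co X.
Let M := - (invmx X *m Co^t*).

(** This is the Lyapunov equation multiplied by [invmx X] on both sides: output
   injection reflects the spectrum of [A] in the imaginary axis. *)
Lemma closed_loop_similar : (A + M *m Co) *m invmx X = - (invmx X *m A^t*).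
Proof.
have [hX uX /eqP] := solX; rewrite subr_eq0 => /eqP EX.
rewrite mulmxDl mulNmx mulNmx -[invmx X *m _ *m Co]mulmxA -EX mulmxDr mulmxDl.
by rewrite mulmxA mulKmx // -!mulmxA mulmxV // mulmx1 opprD addrC subrK.
Qed.

Lemma closed_loop_stable a : (forall b, eigenvalue A b -> 0 < 'Re b) ->
  0 < 'Re a -> a%:M - (A + M *m Co) \in unitmx.
Proof.
have [_ uX _] := solX; move=> unst a_gt0.
suff : (a%:M - (A + M *m Co)) *m invmx X \in unitmx by rewrite unitmx_mul => /andP[].
have -> : (a%:M - (A + M *m Co)) *m invmx X = invmx X *m (a%:M - - A^t*).
  by rewrite mulmxBl closed_loop_similar mulmxBr mulmxN scalar_mxC.
rewrite unitmx_mul unitmx_inv uX unitmx_eigenvalue eigenvalueN eigenvalue_adj.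
apply/negP => /unst; rewrite Re_conj raddfN oppr_gt0 => /lt_trans/(_ a_gt0).
by rewrite ltxx.
Qed.

Lemma closed_loop_allpass :
  let T := realization (A + M *m Co) M Co 1%:M in T *m para T = 1%:M.
Proof.
rewrite /=; have [hX uX /eqP] := solX; rewrite subr_eq0 => /eqP EX.
have adjV : (invmx X)^t* = invmx X.
  rewrite trmx_inv map_invmx; congr invmx.
  by move: hX; rewrite is_hermitianmxE expr0 scale1r => /eqP <-.
set A' := A + M *m Co; pose Z := pencil A'.
have EZ : para Z = - ('X : {poly C})%:F%:M - const_ratmx (A'^t*).
  rewrite /para linearB /= map_mxB tr_scalar_mx map_scalar_mx /=.
  rewrite -/(para (const_ratmx A')) para_const para_rat_tofrac.
  by rewrite /para_poly map_polyX comp_polyX !rmorphN.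
have uZ : Z \in unitmx by apply: unitmx_pencil.
have uZ' : para Z \in unitmx by rewrite map_unitmx unitmx_tr.
have paraV : para (invmx Z) = invmx (para Z) by rewrite /para trmx_inv map_invmx.
pose c := const_ratmx Co; pose c' := const_ratmx (Co^t*).
pose y := const_ratmx (invmx X).
have Ec : para c = c' by apply: para_const.
have Ec' : para c' = c by rewrite para_const adjK.
have Ey : para y = y by rewrite para_const adjV.
have ET : realization A' M Co 1%:M = 1%:M - c *m invmx Z *m (y *m c').
  rewrite /realization -/(pencil _) const_ratmx1 const_ratmxN const_ratmxM.
  by rewrite mulmxN addrC.
have paraT : para (1%:M - c *m invmx Z *m (y *m c')) =
    1%:M - c *m y *m invmx (para Z) *m c'.
  rewrite {1}/para linearB /= map_mxB -!/(para _) para1 !paraM paraV Ec Ec' Ey.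
  by rewrite !mulmxA.
have const_key : - (invmx X *m A'^t*) - A' *m invmx X =
    invmx X *m Co^t* *m Co *m invmx X.
  have A'V : A' *m invmx X = - (invmx X *m A^t*) by apply: closed_loop_similar.
  have VA' : invmx X *m A'^t* = - (A *m invmx X).
    by rewrite -{1}adjV -adjM A'V linearN map_mxN /= adjM adjK adjV.
  rewrite A'V VA' !opprK -[invmx X *m _ *m Co]mulmxA -EX mulmxDr mulmxDl addrC.
  congr (_ + _); last by rewrite mulKmx.
  by rewrite -!mulmxA mulmxV // mulmx1.
have key : y *m para Z + Z *m y = y *m c' *m c *m y.
  rewrite -!const_ratmxM -const_key const_ratmxD !const_ratmxN !const_ratmxM EZ.
  rewrite mulmxBr mulmxBl mulmxN -scalar_mxC.
  by rewrite addrACA addNr add0r.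
by rewrite ET paraT; exact: (allpass_identity uZ uZ' key).
Qed.
End AllPass.
End Lyapunov.

(** * The parametrization of the minimum-phase factors *)

Section Assembly.
Variable C : numClosedFieldType.
Implicit Types (a : C).

(** Properness and regularity on the axis are inherited from the density, so
   only the open right half plane has to be examined. *)
Lemma minimum_phase_of_rhp n r (Phi : 'M[ratfun C]_n) (W : 'M_(n, r)) :
    spectral_density Phi -> spectral_factor Phi W ->
    (forall a, 0 < 'Re a ->
       exists V, mx_value a W V /\ forall v : 'cV_r, V *m v = 0 -> v = 0) ->
  minimum_phase W.
Proof.
move=> [properPhi axisPhi] EW rhp; split.
- by apply: mx_proper_of_mul_para; rewrite -EW.
- move=> a Wa; have [a_gt0|//|a_im] := real_ltgtP (real0 C) (Creal_Re a).
    by have [V [/mx_valueP[]]] := rhp a a_gt0.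
  have [nPa _ _] := axisPhi a (esym a_im).
  have [|V /mx_valueP[]//] := @mx_regular_axis _ _ _ _ W (mx_eval Phi a) (esym a_im).
  by rewrite -EW; apply/mx_valueP.
move=> a [nWa [v v0 Wv0]]; rewrite real_leNgt ?Creal_Re //.
apply/negP=> a_gt0; have [V [/mx_valueP[_ EV] inj]] := rhp a a_gt0.
by rewrite (inj v) ?eqxx -?EV in v0.
Qed.

(** The rows of [Phi] below the full-rank block are combinations of those
   through it, with coefficients [H]. *)
Lemma low_rank_factor m p (Phi : 'M[ratfun C]_(m + p)) (G : 'M_m) (H : 'M_(p, m)) :
    para Phi = Phi -> \rank Phi = m -> \rank (ulsubmx Phi) = m ->
    spectral_factor (ulsubmx Phi) G -> H = dlsubmx Phi *m invmx (ulsubmx Phi) ->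
  spectral_factor Phi (col_mx G (H *m G)).
Proof.
move=> paraPhi rPhi rPhi11 EG EH.
have uPhi : ulsubmx Phi \in unitmx by rewrite -row_full_unit /row_full rPhi11.
have E21 : dlsubmx Phi = H *m ulsubmx Phi by rewrite EH mulmxKV.
have para_ul : para (ulsubmx Phi) = ulsubmx Phi by rewrite EG paraM paraK.
have E12 : ursubmx Phi = ulsubmx Phi *m para H.
  rewrite -[X in X *m _]para_ul -paraM -E21 -{1}paraPhi.
  by apply/matrixP=> i j; rewrite !mxE.
have E22 : drsubmx Phi = H *m ursubmx Phi.
  have le_u : (usubmx Phi <= Phi)%MS.
    by rewrite -{2}(vsubmxK Phi) -addsmxE addsmxSl.
  have : (Phi <= usubmx Phi)%MS.
    have [_ <-] := mxrank_leqif_sup le_u; rewrite eqn_leq mxrankS //= rPhi.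
    move: (eq_leq (esym rPhi11)) => /leq_trans.
    apply; have -> : ulsubmx Phi = usubmx Phi *m lsubmx 1%:M.
      by rewrite mulmx_lsub mulmx1.
    exact: mxrankM_maxl.
  rewrite -{1}(vsubmxK Phi) col_mx_sub => /andP[_ /submxP[K EK]].
  have EKH : K = H.
    rewrite -[K](mulmxK uPhi) EH; congr (_ *m _).
    by rewrite -[dlsubmx _]/(lsubmx (dsubmx Phi)) EK mulmx_lsub.
  by rewrite -[drsubmx _]/(rsubmx (dsubmx Phi)) EK mulmx_rsub EKH.
rewrite /spectral_factor -[LHS]submxK E22 E21 E12 EG.
have -> : para (col_mx G (H *m G)) = row_mx (para G) (para G *m para H).
  by rewrite -paraM /para tr_col_mx map_row_mx.
by rewrite mul_col_row !mulmxA.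
Qed.

(** [T] and [T F] share no left zero at [a]: such a zero direction yields a mode
   of [A] at [a] which the input does not reach. *)
Lemma output_injection_coprime k m n l (F : 'M[ratfun C]_(k, m)) (A : 'M[C]_n)
    (B : 'M_(n, m)) (Co : 'M_(k, n)) D (L : 'M_(n, k)) a (w : 'M_(l, k)) :
    minimal_realization F A B Co D -> a%:M - (A + L *m Co) \in unitmx ->
    w *m (Co *m invmx (a%:M - (A + L *m Co)) *m L + 1%:M) = 0 ->
    w *m (Co *m invmx (a%:M - (A + L *m Co)) *m (B + L *m D) + D) = 0 ->
  w = 0.
Proof.
set A' := A + _ => minF uA'; set x := w *m Co *m invmx (a%:M - A').
rewrite !mulmxDr mulmx1 !mulmxA -/x => xLw xBw.
have wE : w = - (x *m L) by apply/eqP; rewrite -addr_eq0 addrC xLw.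
have xB : x *m B = 0.
  by rewrite wE mulNmx addrK in xBw.
have xA : x *m A = a%:M *m x.
  have : x *m (a%:M - A') = w *m Co by rewrite mulmxKV.
  rewrite wE mulNmx mulmxBr mulmxDr mulmxA opprD addrA => /(canRL (addrK _)).
  by rewrite subrr => /eqP; rewrite subr_eq0 -scalar_mxC => /eqP.
by rewrite wE (minimal_controllable minF xA xB) mul0mx oppr0.
Qed.

End Assembly.

Theorem theorem5p2 (R : realType) (m p : nat) (hm : (0 < m)%N)
  (Phi : 'M[ratfun R[i]]_(m + p))
  (hPhi : spectral_density Phi)
  (hrank : \rank Phi = m)
  (hfull : \rank (ulsubmx Phi) = m)
  (G1 : 'M[ratfun R[i]]_m)
  (hG1 : spectral_factor (ulsubmx Phi) G1)
  (hG1mp : minimum_phase G1)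
  (H : 'M[ratfun R[i]]_(p, m))
  (hH : H = dlsubmx Phi *m invmx (ulsubmx Phi))
  (nu ns : nat)
  (Au : 'M[R[i]]_nu) (Aus : 'M[R[i]]_(nu, ns)) (As : 'M[R[i]]_ns)
  (Bu : 'M[R[i]]_(nu, p)) (Bs : 'M[R[i]]_(ns, p))
  (Cu : 'M[R[i]]_(m, nu)) (Cs : 'M[R[i]]_(m, ns)) (D : 'M[R[i]]_(m, p))
  (hreal : minimal_realization (G1^T *m H^T)
     (block_mx Au Aus 0 As) (col_mx Bu Bs) (row_mx Cu Cs) D)
  (hAu : forall a : R[i], eigenvalue Au a <-> unstable_pole (G1^T *m H^T) a)
  (hAs : forall a : R[i], eigenvalue As a <-> stable_pole (G1^T *m H^T) a) :
  (exists! X : 'M[R[i]]_nu, lyapunov_solution Au Cu X) /\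
  (forall X : 'M[R[i]]_nu, lyapunov_solution Au Cu X ->
    let M := - (invmx X *m Cu^t*) in
    let W2 (P : 'M[R[i]]_m) :=
      (realization (block_mx (Au + M *m Cu) (Aus + M *m Cs) 0 As)
         (col_mx (Bu + M *m D) Bs)
         (row_mx (P *m Cu) (P *m Cs)) (P *m D))^T in
    let Q1 (P : 'M[R[i]]_m) :=
      (realization (Au + M *m Cu) M (P *m Cu) P)^T in
    forall (r : nat) (W : 'M[ratfun R[i]]_(m + p, r)),
      [/\ spectral_factor Phi W, minimum_phase W & \rank W = r] <->
      exists (e : r = m) (P : 'M[R[i]]_m),
        P \is unitarymx /\
        castmx (erefl (m + p)%N, e) W = col_mx (G1 *m Q1 P) (W2 P)).
Proof.
have unstAu (a : R[i]) : eigenvalue Au a -> 0 < 'Re a by case/hAu.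
have stabAs (a : R[i]) : eigenvalue As a -> 'Re a <= 0 by case/hAs.
have obs l (V : 'M_(nu, l)) E : Au *m V = V *m E -> Cu *m V = 0 -> V = 0.
  move=> AV CV; have : col_mx V (0 : 'M_(ns, l)) = 0.
    apply: (minimal_observable (E := E) hreal).
      by rewrite mul_block_col mul_col_mx !mulmx0 !mul0mx !addr0 AV.
    by rewrite mul_row_col mulmx0 addr0.
  by move/(congr1 usubmx); rewrite col_mxKu linear0.
split; first by have := lyapunov_exists_unique unstAu obs.
move=> X solX M W2 Q1.
pose A := block_mx Au Aus 0 As; pose B := col_mx Bu Bs; pose Co := row_mx Cu Cs.
(* The output injection [M] acts on the unstable states only. *)
pose L := col_mx M (0 : 'M_(ns, m)).
pose T := realization (A + L *m Co) L Co 1%:M.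
pose TF := realization (A + L *m Co) (B + L *m D) Co D.
have EA : A + L *m Co = block_mx (Au + M *m Cu) (Aus + M *m Cs) 0 As.
  by rewrite mul_col_row add_block_mx !mul0mx !addr0.
have EB : B + L *m D = col_mx (Bu + M *m D) Bs.
  by rewrite mul_col_mx mul0mx add_col_mx addr0.
have ET : T = realization (Au + M *m Cu) M Cu 1%:M.
  by rewrite /T EA; apply: realization_ublock.
have ETF : TF = T *m (G1^T *m H^T).
  by case: hreal => -> _; apply/esym; apply: realization_output_injection.
have EQ1 P : Q1 P = T^T *m const_ratmx P^T.
  rewrite /Q1 -{2}[P]mulmx1 -realization_mul_const -ET trmx_mul.
  by rewrite /const_ratmx map_trmx.
have EW2 P : W2 P = TF^T *m const_ratmx P^T.
  rewrite /W2 -mul_mx_row -EA -EB -realization_mul_const -/TF trmx_mul.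
  by rewrite /const_ratmx map_trmx.
pose W0 P := col_mx (G1 *m Q1 P) (W2 P).
have EW0 P : W0 P = col_mx G1 (H *m G1) *m (T^T *m const_ratmx P^T).
  rewrite /W0 EQ1 EW2 ETF mul_col_mx !trmx_mul !trmxK !mulmxA.
  by [].
have TT1 : T *m para T = 1%:M by rewrite ET; apply: closed_loop_allpass.
have TT1' : T^T *m para T^T = 1%:M.
  have : para T *m T = 1%:M by apply: mulmx1C.
  move/(congr1 trmx); rewrite trmx_mul trmx1 => <-; congr (_ *m _).
  by rewrite /para map_trmx trmxK.
have EPhi := low_rank_factor (spectral_density_para hPhi) hrank hfull hG1 hH.
have factorW0 P : P \is unitarymx -> spectral_factor Phi (W0 P).
  move=> uP; rewrite /spectral_factor EW0 paraM {1}EPhi.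
  set Q := T^T *m _; have QQ1 : Q *m para Q = 1%:M.
    rewrite /Q paraM para_const -mulmxA [const_ratmx _ *m _]mulmxA -const_ratmxM.
    have /unitarymxP -> : P^T \is unitarymx by rewrite trmx_unitary.
    by rewrite const_ratmx1 mul1mx.
  by rewrite -[RHS]mulmxA [Q *m (_ *m _)]mulmxA QQ1 mul1mx.
have rankW0 P : P \is unitarymx -> \rank (W0 P) = m.
  by move=> uP; rewrite -mxrank_mul_para -(factorW0 P uP).
have mpW0 P : P \is unitarymx -> minimum_phase (W0 P).
  move=> uP; apply: minimum_phase_of_rhp hPhi (factorW0 P uP) _ => a a_gt0.
  have [V [GV injV]] := minimum_phase_inj 1 hG1mp a_gt0.
  have uA : a%:M - (A + L *m Co) \in unitmx.
    rewrite EA; apply: unitmx_ublock.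
      exact: closed_loop_stable.
    rewrite unitmx_eigenvalue; apply/negP => /stabAs.
    by rewrite real_leNgt ?Creal_Re // a_gt0.
  have TV : mx_value a T _ := mx_value_realization L Co 1%:M uA.
  have TFV : mx_value a TF _ := mx_value_realization (B + L *m D) Co D uA.
  set Ra := invmx _ in TV TFV.
  exists (col_mx (V *m ((Co *m Ra *m L + 1%:M)^T *m P^T))
                 ((Co *m Ra *m (B + L *m D) + D)^T *m P^T)).
  split=> [|v].
    apply: mx_value_col.
      apply: mx_valueM GV _; rewrite EQ1.
      exact: mx_valueM (mx_value_tr TV) (mx_value_const a P^T).
    rewrite EW2; exact: mx_valueM (mx_value_tr TFV) (mx_value_const a P^T).
  rewrite mul_col_mx -[0](@col_mx0 _ m p) => /eq_col_mx[].
  rewrite -!(mulmxA _ _ v) => /injV Tv TFv.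
  have uPT : P^T \in unitmx by rewrite unitmx_tr unitarymx_unit.
  (* [P^T *m v], transposed, is a common left zero direction of [T], [T *m F]. *)
  have w0 : (P^T *m v)^T = 0.
    apply: (output_injection_coprime hreal uA); apply/trmx_inj;
      by rewrite trmx_mul trmxK trmx0.
  by rewrite -[v](mulKmx uPT) -[P^T *m v]trmxK w0 trmx0 mulmx0.
move=> r W; split=> [[EW mpW rW] | [e [P [uP EW]]]].
  have u1 : (1%:M : 'M[R[i]]_m) \is unitarymx.
    by apply/unitarymxP; rewrite mul1mx trmx1 map_mx1.
  have [e [K [uK EK]]] := minimum_phase_factor_unique EW mpW rW
    (factorW0 _ u1) (mpW0 _ u1) (rankW0 _ u1).
  (* Multiplying [W0 1] by [K] on the right amounts to taking [P = K^T]. *)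
  exists e, K^T; rewrite trmx_unitary; split=> //.
  rewrite EK -/(W0 K^T) !EW0 trmx1 const_ratmx1 mulmx1 trmxK -mulmxA.
  by [].
subst r; rewrite castmx_id in EW.
by rewrite EW; split; [exact: factorW0 | exact: mpW0 | exact: rankW0].
Qed.
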